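(* Let $a\in\mathbb{N}$ have binary expansion $a_n\cdots a_0$, i.e. $a=\sum_{k=0}^n a_k2^k$ with $a_k\in\{0,1\}$ and $n$ minimal. Then $$\mu_a=\begin{pmatrix} Id & 0\end{pmatrix}A_{a_0}\cdots A_{a_{n-1}}A_{a_n}\begin{pmatrix}\mu_0\\ \mu_1\end{pmatrix},$$ where $$A_0=\begin{pmatrix} Id & 0\\ \frac12 S^{-1} & \frac12 S\end{pmatrix},\qquad A_1=\begin{pmatrix}\frac12 S^{-1} & \frac12 S\\ 0 & Id\end{pmatrix}$$ are matrices whose entries are operators on $l^1(\mathbb{Z})$.
   Context: $\mathbb{N}=\{0,1,2,\dots\}$. For $n\in\mathbb{N}$, $s_2(n)$ is the number of digits $1$ in the binary expansion of $n$. For $a\in\mathbb{N}$, $\mu_a$ is the probability measure on $\mathbb{Z}$ given by $$\mu_a(d)=\lim_{N\to+\infty}\frac1N\#\{n<N : s_2(n+a)-s_2(n)=d\},\qquad d\in\mathbb{Z}$$ (it is known that these limits exist and define a probability measure). The measure $\mu_a$ is identified with the element $(\mu_a(d))_{d\in\mathbb{Z}}$ of $l^1(\mathbb{Z})$. The operator $S:l^1(\mathbb{Z})\to l^1(\mathbb{Z})$ is the shift $S((x_n)_{n\in\mathbb{Z}})=(x_{n+1})_{n\in\mathbb{Z}}$, and $Id$ is the identity operator on $l^1(\mathbb{Z})$. For $a=0$ the binary expansion is the single digit $0$ ($n=0$, $a_0=0$). *)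

(* Defs.v *)
From HB Require Import structures.
From mathcomp Require Import all_boot all_order all_algebra.
From mathcomp Require Import finmap.
From mathcomp Require Import all_classical all_reals all_analysis.
From mathcomp Require Import zify lra.

Set Implicit Arguments.
Unset Strict Implicit.
Unset Printing Implicit Defensive.

Import Order.TTheory GRing.Theory Num.Theory.
Import numFieldNormedType.Exports.

Local Open Scope classical_set_scope.
Local Open Scope ring_scope.

Section L1.
Variable R : realType.

Definition l1_pred : {pred int -> R} :=
  fun x => summable [set: int] (fun d => (x d)%:E).

Record l1 := L1 { l1_fun :> int -> R ; l1_funP : l1_fun \in l1_pred }.

HB.instance Definition _ := [isSub for l1_fun].
HB.instance Definition _ := [Choice of l1 by <:].

Lemma esum_leP (x : int -> R) (M : R) :
  (\esum_(d in [set: int]) `|(x d)%:E| <= M%:E)%E <->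
  (forall X : {fset int}, \sum_(d <- X) `|x d| <= M).
Proof.
split=> [xM X|xM].
  rewrite -lee_fin; apply: le_trans xM; apply: esum_ge.
  exists [set` X]; first by split.
  by rewrite fsbig_finite// set_fsetK sumEFin.
apply: ge_ereal_sup => _ [A [finA _] <-].
rewrite fsbig_finite//= (eq_bigr (fun d => (`|x d|)%:E))//.
by rewrite sumEFin lee_fin.
Qed.

(* The l^1 norm, whose topology gives the continuity required of operators. *)
Definition l1_norm (x : l1) : R := fine (\esum_(d in [set: int]) `|(x d)%:E|)%E.

Lemma l1_normE (x : l1) :
  (\esum_(d in [set: int]) `|(x d)%:E|)%E = (l1_norm x)%:E.
Proof.
by rewrite /l1_norm fineK// -summableE; exact: l1_funP.
Qed.

Lemma l1_predP (x : int -> R) (M : R) :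
  (forall X : {fset int}, \sum_(d <- X) `|x d| <= M) -> x \in l1_pred.
Proof.
by move=> /esum_leP xM; rewrite unfold_in; apply: le_lt_trans xM _; rewrite ltry.
Qed.

Lemma l1_norm_leP (x : l1) (M : R) :
  l1_norm x <= M <-> (forall X : {fset int}, \sum_(d <- X) `|x d| <= M).
Proof. by rewrite -esum_leP l1_normE lee_fin. Qed.

Lemma l1_norm_ge (x : l1) (X : {fset int}) :
  \sum_(d <- X) `|x d| <= l1_norm x.
Proof. by move: X; apply/l1_norm_leP. Qed.

Lemma l1_bound (x y : int -> R) (c : R) (px : x \in l1_pred)
    (py : y \in l1_pred) (X : {fset int}) :
  \sum_(d <- X) `|(c *: x + y) d| <= `|c| * l1_norm (L1 px) + l1_norm (L1 py).
Proof.
apply: (@le_trans _ _ (\sum_(d <- X) (`|c| * `|x d| + `|y d|))).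
  by apply: ler_sum => d _; rewrite -normrM; exact: ler_normD.
rewrite big_split -mulr_sumr /=.
by rewrite lerD ?ler_wpM2l//; [exact: (l1_norm_ge (L1 px))|exact: (l1_norm_ge (L1 py))].
Qed.

Lemma l1_submod_closed : submod_closed l1_pred.
Proof.
split=> [|c x y px py]; last exact: (l1_predP (l1_bound c px py)).
by apply: (@l1_predP _ 0) => X; rewrite big1// => d _; exact: normr0.
Qed.

HB.instance Definition _ :=
  GRing.isSubmodClosed.Build _ _ l1_pred l1_submod_closed.
HB.instance Definition _ := [SubChoice_isSubLmodule of l1 by <:].

Lemma l1_normD (x y : l1) : l1_norm (x + y) <= l1_norm x + l1_norm y.
Proof.
apply/l1_norm_leP => X.
have := l1_bound 1 (l1_funP x) (l1_funP y) X.
by rewrite scale1r normr1 mul1r; case: x y => [x ?] [y ?].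
Qed.

Lemma l1_normZ_le (c : R) (x : l1) : l1_norm (c *: x) <= `|c| * l1_norm x.
Proof.
apply/l1_norm_leP => X.
rewrite (eq_bigr (fun d => `|c| * `|x d|)); last first.
  by move=> d _; exact: (normrM c (x d)).
by rewrite -mulr_sumr ler_wpM2l// l1_norm_ge.
Qed.

Lemma l1_normZ (c : R) (x : l1) : l1_norm (c *: x) = `|c| * l1_norm x.
Proof.
apply/eqP; rewrite eq_le l1_normZ_le /=.
have [->|c0] := eqVneq c 0.
  rewrite normr0 mul0r; apply: le_trans (l1_norm_ge _ fset0).
  by rewrite big_seq_fset0.
have := l1_normZ_le c^-1 (c *: x).
by rewrite scalerA mulVf// scale1r normfV ler_pdivlMl ?normr_gt0.
Qed.

Lemma l1_norm0_eq0 (x : l1) : l1_norm x = 0 -> x = 0.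
Proof.
move=> x0; apply/val_inj/funext => d /=.
have := l1_norm_ge x [fset d]%fset.
by rewrite x0 big_seq_fset1 normr_le0 => /eqP.
Qed.

HB.instance Definition _ :=
  Lmodule_isNormed.Build R l1 l1_normD l1_normZ l1_norm0_eq0.

Lemma l1_fun_norm (x : l1) : `|x| = l1_norm x. Proof. by []. Qed.

End L1.

Section Operators.
Variables (R : realType) (V : normedModType R).

Definition operator_pred : {pred V -> V} :=
  fun f => `[< linear f /\ continuous f >].

(* Continuous linear endomorphisms of V; they form a ring under composition. *)
Record operator :=
  Operator { op_fun :> V -> V ; op_funP : op_fun \in operator_pred }.

HB.instance Definition _ := [isSub for op_fun].
HB.instance Definition _ := [Choice of operator by <:].

Lemma operator_submod_closed : submod_closed operator_pred.
Proof.
split=> [|c f g].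
  apply/asboolP; split; last exact: cst_continuous.
  by move=> a u v /=; rewrite -[RHS]/(a *: 0 + 0 : V) scaler0 addr0.
move=> /asboolP[lf cf] /asboolP[lg cg]; apply/asboolP; split.
  move=> a u v; rewrite -![LHS]/(c *: f _ + g _)
    -![RHS]/(a *: (c *: f _ + g _) + (c *: f _ + g _)).
  by rewrite lf lg !scalerDr !scalerA (mulrC c a) addrACA.
move=> x; apply: (@continuousD _ _ _ (fun z => c *: f z) g); last exact: cg.
by apply: continuousZr; exact: cf.
Qed.

HB.instance Definition _ :=
  GRing.isSubmodClosed.Build _ _ operator_pred operator_submod_closed.
HB.instance Definition _ := [SubChoice_isSubLmodule of operator by <:].

Lemma op_id_subproof : id \in operator_pred.
Proof. by apply/asboolP; split=> // x; exact: cvg_id. Qed.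

Definition op_id := Operator op_id_subproof.

Lemma op_comp_subproof (f g : operator) : f \o g \in operator_pred.
Proof.
case: f g => [f /= /asboolP[lf cf]] [g /= /asboolP[lg cg]].
apply/asboolP; split=> [a u v /=|x]; first by rewrite lg lf.
by apply: continuous_comp; [exact: cg|exact: cf].
Qed.

Definition op_comp (f g : operator) := Operator (op_comp_subproof f g).

Lemma op_linear (f : operator) : linear f.
Proof. by case: f => f /= /asboolP[]. Qed.

Lemma opP (f g : operator) : f =1 g -> f = g.
Proof. by move=> fg; apply/val_inj/funext. Qed.

Fact op_compA : associative op_comp. Proof. by move=> f g h; exact: opP. Qed.
Fact op_comp1l : left_id op_id op_comp. Proof. by move=> f; exact: opP. Qed.
Fact op_comp1r : right_id op_id op_comp. Proof. by move=> f; exact: opP. Qed.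
Fact op_compDl : left_distributive op_comp +%R.
Proof. by move=> f g h; exact: opP. Qed.
Fact op_compDr : right_distributive op_comp +%R.
Proof.
move=> f g h; apply: opP => x.
by have := op_linear f 1 (g x) (h x); rewrite !scale1r.
Qed.

HB.instance Definition _ := GRing.Zmodule_isPzRing.Build operator
  op_compA op_comp1l op_comp1r op_compDl op_compDr.

(* Action of a matrix of operators on a matrix of vectors, with the same
   formula as the matrix product. *)
Definition mulmx_op m n p (M : 'M[operator]_(m, n)) (v : 'M[V]_(n, p)) :
    'M[V]_(m, p) :=
  \matrix_(i, k) \sum_j M i j (v j k).

End Operators.

Notation "M *mv v" := (mulmx_op M v)
  (at level 40, left associativity, format "M  *mv  v") : ring_scope.

Section Shift.
Variable R : realType.

Lemma shift_bound (k : int) (x : l1 R) (X : {fset int}) :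
  \sum_(d <- X) `|x (d + k)| <= `|x|.
Proof.
rewrite l1_fun_norm.
apply: le_trans (l1_norm_ge x [fset (d + k)%R | d in X]%fset).
rewrite big_imfset//=.
by move=> d e _ _ /addIr.
Qed.

Definition shift_fun (k : int) (x : l1 R) : l1 R :=
  L1 (l1_predP (shift_bound k x)).

Lemma shift_subproof (k : int) : shift_fun k \in @operator_pred R (l1 R).
Proof.
have lin : linear (shift_fun k) by move=> a x y; exact: val_inj.
apply/asboolP; split=> //.
pose F := HB.pack_for {linear l1 R -> l1 R} (shift_fun k)
  (GRing.isLinear.Build _ _ _ _ _ lin).
apply: (@bounded_linear_continuous _ _ _ F).
apply/linear_boundedP; near=> M => x.
apply: (@le_trans _ _ `|x|).
  by apply/l1_norm_leP => X; exact: shift_bound.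
by rewrite ler_peMl.
Unshelve. all: by end_near. Qed.

(* (x_n)_n is sent to (x_(n+k))_n. *)
Definition shift (k : int) : operator (l1 R) := Operator (shift_subproof k).

Definition shiftS : operator (l1 R) := shift 1.
Definition shiftSinv : operator (l1 R) := shift (- 1).

Lemma shiftSK : shiftS * shiftSinv = 1.
Proof.
by apply: opP => x; apply/val_inj/funext => d /=; rewrite addrK.
Qed.

Lemma shiftSinvK : shiftSinv * shiftS = 1.
Proof.
by apply: opP => x; apply/val_inj/funext => d /=; rewrite subrK.
Qed.

End Shift.

(* The digit of weight 2 ^ k of n vanishes for k >= n. *)
Definition s2 (n : nat) : nat := (\sum_(k < n) odd (n %/ 2 ^ k))%N.

(* b k is the digit of weight 2 ^ k; minimality of n forbids leading zeros,
   except for a = 0, whose expansion is the single digit 0. *)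
Definition binary_expansion (a n : nat) (b : 'I_n.+1 -> bool) : Prop :=
  a = (\sum_(k < n.+1) b k * 2 ^ k)%N /\
  (forall m (c : 'I_m.+1 -> bool),
     a = (\sum_(k < m.+1) c k * 2 ^ k)%N -> (n <= m)%N).

Definition digit_diff_count (a : nat) (d : int) (N : nat) : nat :=
  #|[set n : 'I_N | (s2 (n + a))%:Z - (s2 n)%:Z == d]%SET|.

Section Mu.
Variable R : realType.

Lemma sum_half (P : nat -> nat) N :
  (\sum_(n < N) P n = \sum_(n < uphalf N) P n.*2 + \sum_(n < N./2) P n.*2.+1)%N.
Proof.
elim: N => [|N IH]; first by rewrite !big_ord0.
rewrite big_ord_recr /= IH.
case: (boolP (odd N)) => oN.
  have uN : uphalf N = N./2.+1 by rewrite uphalf_half oN.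
  have dN : N = N./2.*2.+1 by rewrite -{1}(odd_double_half N) oN.
  by rewrite uN [X in _ = (_ + X)%N]big_ord_recr /= -dN addnA.
have uN : uphalf N = N./2 by rewrite uphalf_half (negbTE oN).
have dN : N = N./2.*2 by rewrite -{1}(odd_double_half N) (negbTE oN).
by rewrite uN [X in _ = (X + _)%N]big_ord_recr /= -dN addnAC.
Qed.

Lemma s2_wide n m : (n <= m)%N -> s2 n = (\sum_(k < m) odd (n %/ 2 ^ k))%N.
Proof.
move=> nm; rewrite /s2 (big_ord_widen m (fun k => odd (n %/ 2 ^ k) : nat) nm).
rewrite big_mkcond; apply: eq_bigr => k _; case: ltnP => // nk.
by rewrite divn_small// (leq_ltn_trans nk)// ltn_expl.
Qed.

Lemma s2_rec n (b : bool) : s2 (n.*2 + b) = (s2 n + b)%N.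
Proof.
have le : (n.*2 + b <= n.*2.+2)%N by case: b; lia.
rewrite (s2_wide le) big_ord_recl /= expn0 divn1 oddD odd_double /= oddb addnC.
have le' : (n <= n.*2.+1)%N by lia.
rewrite (s2_wide le'); congr (_ + _)%N.
apply: eq_bigr => k _; rewrite /bump /= add1n expnS divnMA.
congr (odd (_ %/ _)); rewrite -muln2 divnMDl// divn_small ?addn0//.
by case: b {le}.
Qed.

Lemma s2_double n : s2 n.*2 = s2 n.
Proof. by have := s2_rec n false; rewrite !addn0. Qed.

Lemma s2_doubleS n : s2 n.*2.+1 = (s2 n).+1.
Proof. by have := s2_rec n true; rewrite !addn1. Qed.

Lemma digit_diff_countE a d N :
  digit_diff_count a d N = (\sum_(n < N) ((s2 (n + a))%:Z - (s2 n)%:Z == d)%R)%N.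
Proof.
rewrite /digit_diff_count -sum1dep_card big_mkcond /=; apply: eq_bigr => n _.
by case: eqP.
Qed.

Lemma count0 d N : digit_diff_count 0 d N = (if d == 0 then N else 0)%N.
Proof.
rewrite digit_diff_countE (eq_bigr (fun=> (d == 0 : nat))); last first.
  by move=> n _; rewrite addn0 subrr eq_sym.
by rewrite sum_nat_const card_ord; case: ifP; rewrite ?muln1 ?muln0.
Qed.

Lemma count_double a d N :
  digit_diff_count a.*2 d N =
  (digit_diff_count a d (uphalf N) + digit_diff_count a d N./2)%N.
Proof.
rewrite !digit_diff_countE.
rewrite (sum_half (fun n => ((s2 (n + a.*2))%:Z - (s2 n)%:Z == d)%R)).
congr (_ + _)%N; apply: eq_bigr => n _.
  by rewrite -doubleD !s2_double.
rewrite addSn -doubleD !s2_doubleS; congr nat_of_bool.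
by apply/eqP/eqP; lia.
Qed.

Lemma count_doubleS a d N :
  digit_diff_count a.*2.+1 d N =
  (digit_diff_count a (d - 1) (uphalf N) +
   digit_diff_count a.+1 (d + 1) N./2)%N.
Proof.
rewrite !digit_diff_countE.
rewrite (sum_half (fun n => ((s2 (n + a.*2.+1))%:Z - (s2 n)%:Z == d)%R)).
congr (_ + _)%N; apply: eq_bigr => n _; congr nat_of_bool.
  by rewrite addnS -doubleD s2_doubleS s2_double; apply/eqP/eqP; lia.
rewrite addSnnS -doubleS -doubleD s2_double s2_doubleS.
by apply/eqP/eqP; lia.
Qed.

Lemma s2_succ n : (s2 n.+1 <= (s2 n).+1)%N.
Proof.
elim/ltn_ind: n => n IH; case: (boolP (odd n)) => on; last first.
  have -> : n = n./2.*2 by rewrite -{1}(odd_double_half n) (negbTE on).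
  by rewrite s2_doubleS s2_double.
have dn : n = n./2.*2.+1 by rewrite -{1}(odd_double_half n) on.
have lt : (n./2 < n)%N by lia.
rewrite dn s2_doubleS -doubleS s2_double.
exact: leq_trans (IH _ lt) (leqnSn _).
Qed.

Definition linear_growth (u : nat -> nat) (l : R) :=
  exists C : R, forall N, `|(u N)%:R - l * N%:R| <= C.

Lemma linear_growth_half (u v w : nat -> nat) (l m : R) :
  (forall N, w N = (u (uphalf N) + v N./2)%N) ->
  linear_growth u l -> linear_growth v m -> linear_growth w (2^-1 * l + 2^-1 * m).
Proof.
move=> wE [C uC] [D vD]; exists (C + D + `|l| + `|m|) => N.
have e1 : ((uphalf N)%:R : R) = 2^-1 * N%:R + 2^-1 * (odd N)%:R.
  have /(congr1 (fun k => k%:R : R)) := odd_double_half N.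
  by rewrite uphalf_half !natrD -muln2 natrM; lra.
have e2 : ((N./2)%:R : R) = 2^-1 * N%:R - 2^-1 * (odd N)%:R.
  have /(congr1 (fun k => k%:R : R)) := odd_double_half N.
  by rewrite natrD -muln2 natrM; lra.
have o : 0 <= ((odd N)%:R : R) <= 1 by rewrite ler0n lern1 leq_b1.
have := uC (uphalf N); have := vD N./2.
rewrite wE natrD e1 e2.
set o' := (odd N)%:R in o *; set n := N%:R.
move=> vb ub.
have -> : (u (uphalf N))%:R + (v N./2)%:R - (2^-1 * l + 2^-1 * m) * n =
  ((u (uphalf N))%:R - l * (2^-1 * n + 2^-1 * o')) +
  ((v N./2)%:R - m * (2^-1 * n - 2^-1 * o')) + (l * (2^-1 * o') - m * (2^-1 * o')).
  by lra.
have h : `|2^-1 * o'| <= 1 by rewrite ger0_norm; lra.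
apply: le_trans (ler_normD _ _) _; rewrite -[leRHS]addrA.
apply: lerD; first by apply: le_trans (ler_normD _ _) _; exact: lerD.
apply: le_trans (ler_normB _ _) _.
by apply: lerD; rewrite normrM ler_piMr.
Qed.

Lemma count_growth a d : exists l, linear_growth (digit_diff_count a d) l.
Proof.
have base0 e : exists l, linear_growth (digit_diff_count 0 e) l.
  exists (if e == 0 then 1 else 0); exists 0 => N.
  by rewrite count0; case: ifP => _; rewrite ?mul1r ?mul0r subrr normr0.
have base1 (k : nat) e : 2 <= e + k%:Z ->
    exists l, linear_growth (digit_diff_count 1 e) l.
  elim: k e => [|k IH] e ek.
    exists 0, 0 => N; rewrite digit_diff_countE big1 ?mul0r ?subrr ?normr0// => n _.
    have := s2_succ n; rewrite addn1 => h.
    by case: eqP => // h'; exfalso; lia.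
  have [l lP] := base0 (e - 1).
  have [m mP] := IH (e + 1) ltac:(lia).
  by eexists; apply: linear_growth_half lP mP => N; exact: (count_doubleS 0).
elim/ltn_ind: a d => a IH d.
have [->|a0] := eqVneq a 0%N; first exact: base0.
have [->|a1] := eqVneq a 1%N; first by apply: (base1 `|2 - d|%N); lia.
case: (boolP (odd a)) => oa; last first.
  have da : a = a./2.*2 by rewrite -{1}(odd_double_half a) (negbTE oa).
  have [l lP] := IH a./2 ltac:(lia) d.
  by eexists; apply: (linear_growth_half _ lP lP) => N; rewrite [in LHS]da count_double.
have da : a = a./2.*2.+1 by rewrite -{1}(odd_double_half a) oa.
have [l lP] := IH a./2 ltac:(lia) (d - 1).
have [m mP] := IH a./2.+1 ltac:(lia) (d + 1).
by eexists; apply: linear_growth_half lP mP => N; rewrite [in LHS]da count_doubleS.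
Qed.

Lemma linear_growth_cvg u l :
  linear_growth u l -> (N%:R^-1 * (u N)%:R : R) @[N --> \oo] --> l.
Proof.
move=> [C uC].
apply/cvgrPdist_le => e e0; near=> N.
have N0 : (0 : R) < N%:R by rewrite ltr0n; near: N; exact: nbhs_infty_gt.
rewrite -(ler_pM2l N0) -{1}(gtr0_norm N0) -normrM mulrBr mulVKf ?gt_eqF//.
rewrite distrC mulrC (le_trans (uC N))//.
rewrite mulrC -ler_pdivrMl// mulrC.
near: N; exact: nbhs_infty_ger.
Unshelve. all: by end_near. Qed.

Definition mu_fun (a : nat) (d : int) : R :=
  limn (fun N : nat => N%:R^-1 * (digit_diff_count a d N)%:R : R).

Lemma mu_fun_growth a d : linear_growth (digit_diff_count a d) (mu_fun a d).
Proof.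
have [l lP] := count_growth a d.
by rewrite /mu_fun (cvg_lim _ (linear_growth_cvg lP)).
Qed.

(* limn is total: this is what makes mu_fun the limit of the frequencies. *)
Lemma mu_fun_cvg a d :
  (N%:R^-1 * (digit_diff_count a d N)%:R : R) @[N --> \oo] --> mu_fun a d.
Proof. exact/linear_growth_cvg/mu_fun_growth. Qed.

Lemma mu_fun_ge0 a d : 0 <= mu_fun a d.
Proof.
apply: limr_ge; first by apply/cvg_ex; exists (mu_fun a d); exact: mu_fun_cvg.
by near=> N; rewrite mulr_ge0 ?invr_ge0.
Unshelve. all: by end_near. Qed.

Lemma sum_count_le a (X : {fset int}) N :
  (\sum_(d <- X) digit_diff_count a d N <= N)%N.
Proof.
under eq_bigr do rewrite digit_diff_countE.
rewrite exchange_big /= -[leqRHS]muln1 -[X in (_ <= X * _)%N]card_ord -sum_nat_const.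
apply: leq_sum => n _.
set e := (_ - _)%R.
rewrite (eq_bigr (fun d => if d == e then 1%N else 0%N)); last first.
  by move=> d _; rewrite eq_sym; case: eqP.
rewrite -big_mkcond sum1_count count_uniq_mem ?fset_uniq//.
by case: (_ \in _).
Qed.

Lemma sum_mu_fun_le a (X : {fset int}) : \sum_(d <- X) `|mu_fun a d| <= 1.
Proof.
under eq_bigr do rewrite ger0_norm ?mu_fun_ge0//.
have cv : \sum_(d <- X) (N%:R^-1 * (digit_diff_count a d N)%:R) @[N --> \oo]
    --> (\sum_(d <- X) mu_fun a d : R).
  elim: (X : seq int) => [|d s IH].
    by under eq_fun do rewrite big_nil; rewrite big_nil; exact: cvg_cst.
  under eq_fun do rewrite big_cons; rewrite big_cons.
  by apply: cvgD IH; exact: mu_fun_cvg.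
rewrite -(cvg_lim _ cv)//; apply: limr_le.
  by apply/cvg_ex; exists (\sum_(d <- X) mu_fun a d).
near=> N; rewrite -mulr_sumr -natr_sum.
have N0 : (0 : R) < N%:R by rewrite ltr0n; near: N; exact: nbhs_infty_gt.
by rewrite ler_pdivrMl// mulr1 ler_nat sum_count_le.
Unshelve. all: by end_near. Qed.

Definition mu (a : nat) : l1 R := L1 (l1_predP (sum_mu_fun_le a)).

End Mu.

Section Matrices.
Variable R : realType.

Definition mx22 (T : Type) (a b c d : T) : 'M[T]_2 :=
  \matrix_(i < 2, j < 2)
    (if i == 0 then if j == 0 then a else b else if j == 0 then c else d).

Definition row2 (T : Type) (a b : T) : 'rV[T]_2 :=
  \row_(j < 2) (if j == 0 then a else b).

Definition col2 (T : Type) (a b : T) : 'cV[T]_2 :=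
  \col_(i < 2) (if i == 0 then a else b).

(* The entry 1 is the identity operator. *)
Definition A0 : 'M[operator (l1 R)]_2 :=
  mx22 1                      0
       (2^-1 *: shiftSinv R)  (2^-1 *: shiftS R).

Definition A1 : 'M[operator (l1 R)]_2 :=
  mx22 (2^-1 *: shiftSinv R)  (2^-1 *: shiftS R)
       0                      1.

Definition A (digit : bool) : 'M[operator (l1 R)]_2 :=
  if digit then A1 else A0.

End Matrices.

(* Main.v *)
Require Import Defs.
From mathcomp Require Import all_boot all_order all_algebra.
From mathcomp Require Import all_classical all_reals all_analysis.

Set Implicit Arguments.
Unset Strict Implicit.
Unset Printing Implicit Defensive.

Import GRing.Theory Num.Theory numFieldNormedType.Exports.
Local Open Scope ring_scope.

(* Splitting n by parity gives mu_(2a) = mu_a and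
   mu_(2a+1) = S^-1 mu_a / 2 + S mu_(a+1) / 2, so A_e sends the column
   (mu_a, mu_(a+1)) to (mu_(2a+e), mu_(2a+e+1)); the formula follows by
   reading the digits of a from the most significant one. *)

Lemma linear_growth_lim (R : realType) (u : nat -> nat) (l : R) :
  linear_growth u l -> limn (fun N : nat => N%:R^-1 * (u N)%:R : R) = l.
Proof. by move=> ul; apply: cvg_lim => //; exact: linear_growth_cvg ul. Qed.

Lemma mu_double (R : realType) (a : nat) : mu R a.*2 = mu R a.
Proof.
apply/val_inj/funext => d /=; apply: linear_growth_lim.
(* Puts the slope in the averaged form that [linear_growth_half] produces. *)
have -> : mu_fun R a d = 2^-1 * mu_fun R a d + 2^-1 * mu_fun R a d.
  by rewrite -mulrDl -[2^-1]mul1r -splitr mul1r.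
exact: (linear_growth_half (count_double a d)
  (mu_fun_growth R a d) (mu_fun_growth R a d)).
Qed.

(** For even [n] the final 1 of [a.*2.+1] adds one digit 1, whence [d - 1]; for odd [n] the carry
    turns [a] into [a.+1] and the final 1 of [n] is lost, whence [d + 1]. *)
Lemma mu_doubleS (R : realType) (a : nat) :
  mu R a.*2.+1 = 2^-1 *: shiftSinv R (mu R a) + 2^-1 *: shiftS R (mu R a.+1).
Proof.
apply/val_inj/funext => d; apply: linear_growth_lim.
exact: (linear_growth_half (count_doubleS a d)
  (mu_fun_growth R a (d - 1)) (mu_fun_growth R a.+1 (d + 1))).
Qed.

Section MatrixAction.
Variables (R : realType) (V : normedModType R).

Lemma op_sum (f : operator V) (I : Type) (r : seq I) (F : I -> V) :
  f (\sum_(i <- r) F i) = \sum_(i <- r) f (F i).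
Proof.
apply: (big_morph f) => [x y|].
  by have := op_linear f 1 x y; rewrite !scale1r.
(* Linearity with scalar -1 at 0 reads [f 0 = - f 0 + f 0]. *)
by have := op_linear f (-1) 0 0; rewrite scaleN1r addNr scaleN1r addNr.
Qed.

Lemma sum_op (I : Type) (r : seq I) (F : I -> operator V) (x : V) :
  (\sum_(i <- r) F i) x = \sum_(i <- r) F i x.
Proof. exact: (big_morph (fun f : operator V => f x)). Qed.

(** Lets a matrix product act one factor at a time; additivity of the entries of [M] moves them
    inside the sum. *)
Lemma mulmx_opA m n p q (M : 'M[operator V]_(m, n)) (N : 'M[operator V]_(n, p))
    (v : 'M[V]_(p, q)) :
  (M *m N) *mv v = M *mv (N *mv v).
Proof.
apply/matrixP => i k; rewrite !mxE.
under eq_bigr do rewrite mxE sum_op.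
rewrite exchange_big /=; apply: eq_bigr => j _.
by rewrite mxE op_sum.
Qed.

Lemma mul1mx_op n p (v : 'M[V]_(n, p)) : 1%:M *mv v = v.
Proof.
apply/matrixP => i k; rewrite !mxE (bigD1 i)//= mxE eqxx big1 ?addr0//.
by move=> j /negPf ji; rewrite mxE eq_sym ji.
Qed.

End MatrixAction.

(** The row of [A R e] with an identity entry gives the even index, [a.*2] or [a.+1.*2]; the other
    row gives [a.*2.+1]. *)
Lemma A_mu (R : realType) (e : bool) (a : nat) :
  A R e *mv col2 (mu R a) (mu R a.+1) =
  col2 (mu R (a.*2 + e)) (mu R (a.*2 + e).+1).
Proof.
apply/colP => i; rewrite !mxE big_ord_recl big_ord1.
case: e; rewrite /A !mxE /= ?addn1 ?addn0 -?doubleS ?mu_double mu_doubleS;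
  case: eqP => _; rewrite ?add0r ?addr0 //.
Qed.

(** Induction peels off the leftmost factor, which carries the lowest digit and acts last, on the
    pair built from the higher digits. *)
Lemma prod_A_mu (R : realType) (n : nat) (b : 'I_n -> bool) :
  (\prod_(k < n) A R (b k)) *mv col2 (mu R 0) (mu R 1) =
  let a := (\sum_(k < n) b k * 2 ^ k)%N in col2 (mu R a) (mu R a.+1).
Proof.
elim: n b => [|n IH] b /=; first by rewrite !big_ord0 mul1mx_op.
rewrite big_ord_recl mulmx_opA IH A_mu big_ord_recl expn0 muln1 addnC.
suff -> : (\sum_(i < n) b (lift ord0 i) * 2 ^ lift ord0 i)%N =
          (\sum_(k < n) b (lift ord0 k) * 2 ^ k)%N.*2 by [].
rewrite -muln2 big_distrl /=; apply: eq_bigr => k _.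
by rewrite /bump /= add1n expnSr mulnA.
Qed.

Theorem proposition2p5 (R : realType) (a n : nat) (b : 'I_n.+1 -> bool)
    (hb : binary_expansion a b) :
  mu R a =
  ((row2 1 0 *m \prod_(k < n.+1) A R (b k)) *mv col2 (mu R 0) (mu R 1)) 0 0.
Proof.
case: hb => ab _.
rewrite mulmx_opA prod_A_mu -ab !mxE big_ord_recl big_ord1 !mxE /=.
(* The operators 1 and 0 of the row act by computation. *)
by rewrite -[RHS]/(mu R a + 0) addr0.
Qed.
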